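(* Let $p\ge 2$ be a constant, $k\ge1$, $n\ge 2$, $0<\varepsilon<1$. Each site $i\in[k]$ holds a vector $v^{(i)}\in\mathbb Z_{\ge0}^n$ with entries bounded by $\mathrm{poly}(n)$; let $v=\sum_i v^{(i)}$ and $\ell_p'(v)=\big(\sum_{i=1}^k\sum_{j=1}^n v_{ij}^p\big)^{1/p}$. Consider the following protocol. Each site sends $F_p(v^{(i)})=\sum_j v_{ij}^p$ to the coordinator, which computes $\ell_p'(v)$ and broadcasts it. Each site $i$ forms $\tilde v^{(i)}$ with $\tilde v_{ij}=v_{ij}$ if $v_{ij}\ge \varepsilon\ell_p'(v)/k$ and $\tilde v_{ij}=0$ otherwise. Then, with $\varepsilon'=\varepsilon^{p/2}/k^{p/2-1}$, the following sampling protocol is run on the vectors $\tilde v^{(i)}$: each site $i$ computes $F_2(\tilde v^{(i)})=\sum_j\tilde v_{ij}^2$ and, for each $j$, independently sends $\tilde v_{ij}$ to the coordinator with probability $p_{ij}=\min\{1,\frac{3\tilde v_{ij}^2}{\varepsilon'^2F_2(\tilde v^{(i)})}\}$; the coordinator outputs $\hat v_j=\sum_{i=1}^k\frac{\tilde v_{ij}}{p_{ij}}\mathbf 1(\text{site } i\text{ sent }\tilde v_{ij})$. Then for each $j\in[n]$, with probability at least $2/3$, $|\hat v_j-v_j|\le 2\varepsilon\,\ell_p'(v)$, and the expected communication cost is $O\!\left(\frac{k^{p-1}\log n}{\varepsilon^p}\right)$ bits.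
   Context: Coordinator model: $k$ sites and a coordinator; site $i$ knows only $v^{(i)}$; communication cost is the total number of bits exchanged. Terms with $\tilde v_{ij}=0$ contribute $0$ to $\hat v_j$.
   Formalization: Real messages have no defined bit length, so F_p(v^(i)) and ℓ_p'(v) are charged as fixed-point numbers with units n^-b and k·n^-b (b any constant, O-constant depends on b), while the protocol itself computes with the exact values. *)

(* Defs.v *)
(* MathComp / MathComp-Analysis. *)
From HB Require Import structures.
From mathcomp Require Import all_boot all_order all_algebra.
From mathcomp Require Import all_classical all_reals all_analysis.

Set Implicit Arguments.
Unset Strict Implicit.
Unset Printing Implicit Defensive.

Import Order.TTheory GRing.Theory Num.Theory.
Import numFieldNormedType.Exports.

Local Open Scope classical_set_scope.
Local Open Scope ring_scope.

(* What a single site computes.  These functions see only the site's own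
   vector x and what the coordinator broadcast (l stands for ell_p'(v)). *)
Section site.
Context {R : realType} {n : nat}.

Definition Fp (p : R) (x : 'I_n -> nat) : R := \sum_(j < n) (x j)%:R `^ p.

Definition F2 (x : 'I_n -> nat) : nat := (\sum_(j < n) x j ^ 2)%N.

Definition thresholded (k : nat) (eps l : R) (x : 'I_n -> nat) : 'I_n -> nat :=
  fun j => if eps * l / k%:R <= (x j)%:R then x j else 0%N.

(* If x = 0 then F2 x = 0 and the quotient is 0 / 0 = 0: nothing is sent. *)
Definition send_prob (eps' : R) (x : 'I_n -> nat) (j : 'I_n) : R :=
  Num.min 1 (3 * (x j)%:R ^+ 2 / (eps' ^+ 2 * (F2 x)%:R)).

End site.

Section protocol.
Context {R : realType} {k n : nat}.
Implicit Types (p eps : R) (v : 'I_k -> 'I_n -> nat).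

Definition vsum v (j : 'I_n) : nat := (\sum_(i < k) v i j)%N.

Definition lp' p v : R :=
  (\sum_(i < k) \sum_(j < n) (v i j)%:R `^ p) `^ p^-1.

Definition vtilde p eps v (i : 'I_k) : 'I_n -> nat :=
  thresholded k eps (lp' p v) (v i).

Definition eps_sampling p eps : R := eps `^ (p / 2) / k%:R `^ (p / 2 - 1).

Definition prob p eps v (i : 'I_k) (j : 'I_n) : R :=
  send_prob (eps_sampling p eps) (vtilde p eps v i) j.

(* [sent i j] is the event that site i sends its j-th thresholded entry.
   A term with vtilde p eps v i j = 0 is 0, as 0 / 0 = 0. *)
Definition vhat {T : Type} (sent : 'I_k -> 'I_n -> set T) p eps v
    (j : 'I_n) (w : T) : R :=
  \sum_(i < k)
    (vtilde p eps v i j)%:R / prob p eps v i j * \1_(sent i j) w.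

End protocol.

(* Length of the Elias gamma codeword of m.+1, so that messages are
   self-delimiting: twice the binary length of m.+1, minus 1. *)
Definition nat_bits (m : nat) : nat := (2 * trunc_log 2 m.+1)%N.+1.

(* A nonnegative real is transmitted in fixed point, as the number of whole
   multiples of a unit known to both ends. *)
Definition real_bits {R : realType} (unit x : R) : nat :=
  nat_bits (Num.truncn (x / unit)).

(* Number of bits exchanged for the outcome w of the coins.  The computations
   of the protocol are exact; only the charge for the two kinds of real
   messages, F_p(v^(i)) and ell_p'(v), depends on a precision, n^-b for an
   arbitrary constant b.
   - F_p(v^(i)): unit n^-b.  For integer p this is an integer, and b = 0 is
     the exact encoding.
   - ell_p'(v), sent separately to each of the k sites: unit k * n^-b, since
     sites know k and use only ell_p'(v) / k.  When k <= n^a, taking b + a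
     for b makes this unit at most n^-b.
   - F_2 of the thresholded vector: the coordinator needs it for the p_ij.
   - a sampled entry: its index j and its integer value. *)
Definition comm_cost {R : realType} {k n : nat} {T : Type} (b : nat)
    (sent : 'I_k -> 'I_n -> set T) (p eps : R) (v : 'I_k -> 'I_n -> nat)
    (w : T) : R :=
  \sum_(i < k) (real_bits (n%:R ^- b) (Fp p (v i)))%:R
  + k%:R * (real_bits (k%:R * n%:R ^- b) (lp' p v))%:R
  + \sum_(i < k) (nat_bits (F2 (vtilde p eps v i)))%:R
  + \sum_(i < k) \sum_(j < n)
      (up_log 2 n + nat_bits (vtilde p eps v i j))%N%:R * \1_(sent i j) w.

Definition mutually_independent {d : measure_display} {T : measurableType d}
    {R : realType} (P : probability T R) {I : finType} (E : I -> set T) : Prop :=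
  forall A : {set I},
    P (\bigcap_(i in [set` A]) E i) = (\prod_(i in A) P (E i))%E.

(* Main.v *)
Require Import Defs.
From HB Require Import structures.
From mathcomp Require Import all_boot all_order all_algebra.
From mathcomp Require Import all_classical all_reals all_analysis.
From mathcomp Require Import measurable_realfun.
From mathcomp Require Import ring lra zify.

(* Write L for ell_p'(v).  Dropping the entries below eps L / k changes v_j by
   at most eps L.  An entry x that survives satisfies
   x^2 (eps L / k)^(p-2) <= x^p, so that eps'^2 sum_i F_2(v~^(i)) <= (eps L)^2.
   A sampled entry contributes at most eps'^2 F_2(v~^(i)) / 3 to the variance
   of v^_j, which is therefore at most (eps L)^2 / 3, and Chebyshev's
   inequality applies.  Each site sends at most 3 / eps'^2 entries in
   expectation, and every message has O(log n) bits. *)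

Set Implicit Arguments.
Unset Strict Implicit.
Unset Printing Implicit Defensive.

Import Order.TTheory GRing.Theory Num.Theory.
Import numFieldNormedType.Exports.

Local Open Scope classical_set_scope.
Local Open Scope ring_scope.

(** * Lengths of encoded messages, in multiples of [ln n] *)

Lemma nat_bits_le (R : realType) (n e m : nat) : (2 <= n)%N -> (m <= n ^ e)%N ->
  (nat_bits m)%:R <= (2 * e + 3)%N%:R / ln 2 * ln n%:R :> R.
Proof.
move=> n2 mn; set t := trunc_log 2 m.+1.
have n0 : 0 < n%:R :> R by rewrite ltr0n; lia.
have l2 : 0 < ln 2 :> R by rewrite ln_gt0 // ltr1n.
have ln2n : ln 2 <= ln n%:R :> R by rewrite ler_ln ?posrE// ler_nat.
(* As [n >= 2] and [n ^ e >= 1], [m + 1 <= n ^ e + 1 <= n ^ (e + 1)]. Hence [t] is at most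
   [(e + 1) * ln n / ln 2], and the odd bit of [2 * t + 1] is paid for by [ln 2 <= ln n], which
   gives [2 * e + 3]. *)
have ht : (2 ^ t <= n ^ e.+1)%N.
  apply: (leq_trans (trunc_logP _ _)) => //.
  rewrite expnS; have : (0 < n ^ e)%N by rewrite expn_gt0; lia.
  by nia.
have {}ht : t%:R * ln 2 <= e.+1%:R * ln n%:R :> R.
  rewrite mulr_natl [X in _ <= X]mulr_natl -lnXn ?ltr0n// -lnXn//.
  by rewrite ler_ln ?posrE ?exprn_gt0// -!natrX ler_nat.
rewrite mulrAC ler_pdivlMr// /nat_bits -/t.
have -> : (2 * t).+1%:R = 2 * t%:R + 1 :> R by rewrite -natr1 natrM.
by rewrite natrD natrM -natr1 in ht *; nra.
Qed.

Lemma real_bits_le (R : realType) (n e : nat) (u x : R) : (2 <= n)%N ->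
  x / u <= n%:R ^+ e ->
  (real_bits u x)%:R <= (2 * e + 3)%N%:R / ln 2 * ln n%:R :> R.
Proof.
move=> n2 xu; apply: nat_bits_le => //.
by rewrite truncn_le_nat (le_lt_trans xu)// -natrX ltr_nat.
Qed.

Lemma up_log2_le (R : realType) (n : nat) : (2 <= n)%N ->
  (up_log 2 n)%:R <= 2 / ln 2 * ln n%:R :> R.
Proof.
move=> n2; have l2 : 0 < ln 2 :> R by rewrite ln_gt0 // ltr1n.
have ln2n : ln 2 <= ln n%:R :> R by rewrite ler_ln ?posrE ?ltr0n ?ler_nat//; lia.
(* The rounded-up logarithm exceeds the true one by at most 1, and [1 <= ln n / ln 2]; together they
   give the factor 2. *)
have hu : (2 ^ (up_log 2 n).-1 <= n)%N.
  by case/andP: (up_log_bounds (ltnSn 1) n2) => /ltnW.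
have {}hu : (up_log 2 n).-1%:R * ln 2 <= ln n%:R :> R.
  rewrite mulr_natl -lnXn ?ltr0n// ler_ln ?posrE ?exprn_gt0// ?ltr0n; last by lia.
  by rewrite -natrX ler_nat.
rewrite mulrAC ler_pdivlMr//.
have -> : (up_log 2 n)%:R = (up_log 2 n).-1%:R + 1 :> R.
  by rewrite natr1 prednK// up_log_gt0.
by nra.
Qed.

(** * Moments and concentration of weighted sums of indicators *)

Section indicator_sum.
Context {d : measure_display} {T : measurableType d} {R : realType}.
Variable P : probability T R.

Lemma Lfun2_indic (A : set T) : measurable A -> (\1_A : T -> R) \in Lfun P 2%:E.
Proof.
move=> mA; rewrite inE; apply/andP; split; rewrite inE/=.
  exact: measurable_indic.

rewrite /finite_norm unlock poweR_lty//.
rewrite (@le_lt_trans _ _ (\int[P]_x cst (1 : \bar R) x)%E)//.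
  apply: ge0_le_integral => //=.
  - apply/measurable_EFinP/(@measurableT_comp _ _ _ _ _ _ (@powR R ^~ 2))=> //.
    by apply: measurableT_comp => //; exact: measurable_indic.
  - move=> x _; rewrite lee_fin powR_mulrn// indicE.
    by case: (_ \in _); rewrite ?normr0 ?normr1 ?expr1n ?expr0n.
by rewrite integral_cst//= mul1e probability_setT ltry.
Qed.

Variables (I : finType) (a : I -> R) (A : I -> set T).
Hypothesis mA : forall i, measurable (A i).

Let sum_indic := fun w => \sum_i a i * \1_(A i) w.

Lemma sum_indicE : sum_indic = \sum_i (a i \o* \1_(A i)).
Proof.
by apply/funext => w; rewrite fct_sumE; apply: eq_bigr => i _; rewrite mulrC.
Qed.

Lemma Lfun2_sum_indic : sum_indic \in Lfun P 2%:E.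
Proof.
rewrite sum_indicE; apply: rpred_sum => [|? i _]; first exact: lee1n.
by apply: Lfun_scale; rewrite ?ler1n// Lfun2_indic.
Qed.

Lemma measurable_sum_indic : measurable_fun setT sum_indic.
Proof. by have := Lfun2_sum_indic; rewrite inE => /andP[+ _]; rewrite inE. Qed.

Lemma expectation_sum_indic :
  ('E_P[sum_indic] = \sum_i (a i)%:E * P (A i))%E.
Proof.
have L1 i : (\1_(A i) : T -> R) \in Lfun P 1.
  by apply: Lfun_subset12; rewrite ?fin_num_measure// Lfun2_indic.
rewrite sum_indicE -(big_map (fun i => a i \o* \1_(A i)) xpredT id).
rewrite expectation_sum => [|_ /mapP[i _ ->]]; last by rewrite Lfun_scale.
rewrite big_map; apply: eq_bigr => i _.
by rewrite expectationZl// expectation_indic.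
Qed.

End indicator_sum.

Lemma measurable_dist_itv (d : measure_display) (T : measurableType d)
    (R : realType) (X : T -> R) (m : R) (i : interval R) :
  measurable_fun setT X -> measurable [set w | `|X w - m| \in i].
Proof.
move=> mX; have mY : measurable_fun setT (fun w => `|X w - m|).
  by apply: measurableT_comp => //; exact: measurable_funB.
by have := mY measurableT _ (measurable_itv i); rewrite setTI.
Qed.

(** The square of the sum is again a weighted sum of indicators, of the pairwise intersections. So
    pairwise independence is enough, and only the diagonal pairs survive the subtraction of the
    squared mean. *)
Lemma variance_sum_indic (d : measure_display) (T : measurableType d)
    (R : realType) (P : probability T R) (I : finType) (a q : I -> R)
    (A : I -> set T) :
  (forall i, measurable (A i)) -> (forall i, P (A i) = (q i)%:E) ->
  (forall i j, i != j -> P (A i `&` A j) = (q i * q j)%:E) ->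
  ('V_P[fun w => (\sum_i a i * \1_(A i) w)%R]
    = (\sum_i a i ^+ 2 * (q i * (1 - q i)))%R%:E)%E.
Proof.
move=> mA PA indep.
rewrite varianceE; last exact: Lfun2_sum_indic.
have -> : (fun w => \sum_i a i * \1_(A i) w) ^+ 2 = 
    fun w => \sum_(ij : I * I) (a ij.1 * a ij.2) * \1_(A ij.1 `&` A ij.2) w.
  apply/funext => w; rewrite fctE expr2 big_distrlr/= pair_big/=.
  by apply: eq_bigr => -[i j] _ /=; rewrite indicI mulrACA.
rewrite expectation_sum_indic ?expectation_sum_indic//; last first.
  by move=> ij; exact: measurableI.
(* One formula for both cases: on the diagonal, [q = q * q + q * (1 - q)]. *)
have PAI i j :
    P (A i `&` A j) = (q i * q j + (i == j)%:R * (q i * (1 - q i)))%:E.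
  have [->|ij] := eqVneq i j; last by rewrite indep// mul0r addr0.
  by rewrite setIid PA mul1r; congr _%:E; ring.
under eq_bigr do rewrite PAI.
under [X in (_ - X ^+ 2)%E]eq_bigr do rewrite PA.
rewrite !sumEFin -EFin_expe -EFinB; congr _%:E.
rewrite expr2 big_distrlr/= pair_big/= -sumrB.
rewrite -(pair_big xpredT xpredT (fun i j =>
  a i * a j * (q i * q j + (i == j)%:R * (q i * (1 - q i)))
  - a i * q i * (a j * q j)))/=.
apply: eq_bigr => i _; rewrite (bigD1 i)//= big1 => [|j ji].
  by rewrite eqxx mul1r; ring.
by rewrite eq_sym (negPf ji) mul0r; ring.
Qed.

(** Here [s] bounds the variance relative to [r ^+ 2]. Chebyshev controls the event of a deviation
    at least [r], so its complement has a strict inequality. *)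
Lemma chebyshev_sum_indic (d : measure_display) (T : measurableType d)
    (R : realType) (P : probability T R) (I : finType) (a q : I -> R)
    (A : I -> set T) (r s : R) :
  (forall i, measurable (A i)) -> (forall i, P (A i) = (q i)%:E) ->
  (forall i j, i != j -> P (A i `&` A j) = (q i * q j)%:E) ->
  0 < r -> \sum_i a i ^+ 2 * (q i * (1 - q i)) <= s * r ^+ 2 ->
  ((1 - s)%:E <=
    P [set w | `|\sum_i a i * \1_(A i) w - \sum_i a i * q i| < r]%R)%E.
Proof.
move=> mA PA indep r0 hs.
pose X w := \sum_i a i * \1_(A i) w.
have mX : measurable_fun setT X by exact: (measurable_sum_indic P).
have EX : ('E_P[X] = (\sum_i a i * q i)%R%:E)%E.
  rewrite expectation_sum_indic// -sumEFin.
  by apply: eq_bigr => i _; rewrite PA.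
have := @chebyshev _ _ _ P (mfun_Sub (mem_set mX)) r r0.
rewrite mfun_valP -/X EX/= (variance_sum_indic a mA PA indep) -EFinM.
set B := [set x | _] => hB.
have mB : measurable B.
  have := measurable_dist_itv (\sum_i a i * q i) `[r, +oo[ mX.
  by congr measurable; apply/seteqP; split=> w /=; rewrite in_itv/= andbT.
have -> : [set w | `|\sum_i a i * \1_(A i) w - \sum_i a i * q i| < r] = ~` B.
  by apply/seteqP; split => w /=; rewrite ltNge => /negP.
rewrite probability_setC// EFinB leeB// (le_trans hB)// lee_fin.
by rewrite mulrC ler_pdivrMr// exprn_gt0.
Qed.

(** * The effect of dropping small entries on the second moments *)

Section thresholding.
Context {R : realType} {k n : nat}.
Implicit Types (p eps : R) (v : 'I_k -> 'I_n -> nat).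

Lemma lp'_ge0 p v : 0 <= lp' p v.
Proof. exact: powR_ge0. Qed.

Lemma powR_lp' p v : p != 0 -> lp' p v `^ p = \sum_(i < k) Fp p (v i).
Proof.
move=> p0; rewrite /lp' -powRrM mulVf// powRr1//.
by apply: sumr_ge0 => i _; apply: sumr_ge0 => j _; exact: powR_ge0.
Qed.

(** Serves the degenerate case of the error bound, in which Chebyshev would be applied with radius
    0. *)
Lemma lp'_eq0 p v i j : p != 0 -> lp' p v = 0 -> v i j = 0%N.
Proof.
move=> p0 l0; have := powR_lp' v p0; rewrite l0 powR0// => /esym/eqP.
have F0 i' : 0 <= Fp p (v i') by apply: sumr_ge0 => ? _; exact: powR_ge0.
rewrite psumr_eq0// => /allP/(_ i); rewrite mem_index_enum => /(_ isT)/=.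
rewrite psumr_eq0 => [|? _]; last exact: powR_ge0.
move=> /allP/(_ j); rewrite mem_index_enum => /(_ isT)/=.
by rewrite powR_eq0 p0 andbT pnatr_eq0 => /eqP.
Qed.

Lemma thresholded_le eps l (x : 'I_n -> nat) j :
  (thresholded k eps l x j <= x j)%N.
Proof. by rewrite /thresholded; case: ifP. Qed.

Lemma F2_thresholded_le p eps l (x : 'I_n -> nat) : 2 <= p -> (0 < k)%N ->
  0 < eps -> 0 < l ->
  (F2 (thresholded k eps l x))%:R * (eps * l / k%:R) `^ (p - 2) <= Fp p x.
Proof.
move=> p2 k0 e0 l0; rewrite /F2 natr_sum mulr_suml; apply: ler_sum => j _.
have t0 : 0 < eps * l / k%:R by rewrite divr_gt0 ?mulr_gt0// ltr0n.
rewrite /thresholded; case: ifPn => [tx|_]; last first.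
  by rewrite exp0n// mul0r powR_ge0.
have x0 := lt_le_trans t0 tx.
have -> : (x j)%:R `^ p = (x j)%:R ^+ 2 * (x j)%:R `^ (p - 2) :> R.
  by rewrite -powR_mulrn ?ltW// -powRD ?subrKC// (gt_eqF x0) implybT.
rewrite natrX ler_wpM2l ?exprn_ge0//.
by rewrite ge0_ler_powR ?subr_ge0// nnegrE ltW.
Qed.

Lemma eps_sampling_gt0 p eps : (0 < k)%N -> 0 < eps ->
  0 < eps_sampling (k := k) p eps.
Proof. by move=> k0 e0; rewrite divr_gt0 ?powR_gt0 ?ltr0n. Qed.

Lemma eps_sampling_sqr p eps :
  eps_sampling (k := k) p eps ^+ 2 = eps `^ p / k%:R `^ (p - 2).
Proof.
rewrite /eps_sampling exprMn exprVn -!powR_mulrn ?powR_ge0// -!powRrM.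
by rewrite mulrBl mul1r !divfK// pnatr_eq0.
Qed.

(** The reason for the choice of [eps']. Summing the bound for one site gives
    [S * (eps * L / k) ^ (p - 2) <= L ^ p]; cancelling [L ^ (p - 2)] and multiplying by [eps ^ 2]
    leaves exactly [eps' ^ 2 = eps ^ p / k ^ (p - 2)] in front of [S]. *)
Lemma eps_sampling_sum_F2_le p eps v : 2 <= p -> (0 < k)%N -> 0 < eps ->
  0 < lp' p v ->
  eps_sampling (k := k) p eps ^+ 2 * \sum_(i < k) (F2 (vtilde p eps v i))%:R
    <= (eps * lp' p v) ^+ 2.
Proof.
move=> p2 k0 e0 l0; have p0 : 0 < p by lra.
have K0 : 0 < k%:R :> R by rewrite ltr0n.
set S := \sum_(i < k) _; set L := lp' p v in l0 *.
have hS : S * (eps * L / k%:R) `^ (p - 2) <= L `^ p.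
  rewrite powR_lp' ?gt_eqF// mulr_suml; apply: ler_sum => i _.
  exact: F2_thresholded_le.
have D x : 0 < x -> x `^ p = x ^+ 2 * x `^ (p - 2).
  by move=> x0; rewrite -powR_mulrn ?ltW// -powRD ?subrKC// (gt_eqF x0) implybT.
move: hS; rewrite eps_sampling_sqr !powRM ?mulr_ge0 ?invr_ge0 ?(ltW e0) ?(ltW l0)//.
have -> : (k%:R^-1) `^ (p - 2) = (k%:R `^ (p - 2))^-1 :> R.
  by rewrite -[k%:R^-1]powR_inv1 ?(ltW K0)// -powRrM mulN1r powRN.
rewrite (D _ e0) (D _ l0).
have := powR_gt0 (p - 2) l0; have := powR_gt0 (p - 2) K0.
set a := eps `^ _; set b := k%:R `^ _; set c := L `^ _ => b0 c0.
have -> : S * (a * c / b) = S * a / b * c by ring.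
rewrite ler_pM2r// => hS.
have -> : eps ^+ 2 * a / b * S = eps ^+ 2 * (S * a / b) by ring.
by rewrite exprMn ler_wpM2l// exprn_ge0// ltW.
Qed.

End thresholding.

(** * Sampling at a single site: expected number of messages, mean and variance *)

Section sampling.
Context {R : realType} {n : nat}.
Implicit Types (e : R) (x : 'I_n -> nat).

Lemma F2_gt0 x j : (0 < x j)%N -> (0 < F2 x)%N.
Proof.
by move=> xj; rewrite /F2 (bigD1 j)//= addn_gt0 expn_gt0 xj.
Qed.

Lemma send_prob_ge0 e x j : 0 <= send_prob e x j.
Proof. by rewrite /send_prob le_min ler01/= divr_ge0// mulr_ge0// sqr_ge0. Qed.

Lemma send_prob_gt0 e x j : 0 < e -> (0 < x j)%N -> 0 < send_prob e x j.
Proof.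
move=> e0 xj; rewrite /send_prob lt_min ltr01/=.
by apply: divr_gt0; rewrite mulr_gt0 ?exprn_gt0 ?ltr0n ?(F2_gt0 xj).
Qed.

Lemma sum_send_prob_le e x : 0 < e ->
  \sum_(j < n) send_prob e x j <= 3 / e ^+ 2.
Proof.
move=> e0; have e20 : 0 < e ^+ 2 by rewrite exprn_gt0.
apply: (@le_trans _ _ (\sum_(j < n) 3 * (x j)%:R ^+ 2 / (e ^+ 2 * (F2 x)%:R))).
  by apply: ler_sum => j _; rewrite ge_min lexx orbT.
rewrite -mulr_suml -mulr_sumr.
have -> : \sum_(j < n) (x j)%:R ^+ 2 = (F2 x)%:R :> R.
  by rewrite natr_sum; apply: eq_bigr => j _; rewrite natrX.
(* A site whose vector is zero has [F2 x = 0]; the quotient is then 0 by convention, and the bound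
   is trivial. *)
rewrite invfM mulrACA; have [->|F0] := eqVneq (F2 x)%:R (0 : R).
  by rewrite mul0r mulr0 divr_ge0// ltW.
by rewrite divff// mulr1.
Qed.

(** Unbiasedness of one term of the estimate. A zero entry, whose sending probability is 0, is
    covered since its numerator vanishes. *)
Lemma sample_mean e x j : 0 < e ->
  (x j)%:R / send_prob e x j * send_prob e x j = (x j)%:R :> R.
Proof.
move=> e0; have [->|xj] := posnP (x j); first by rewrite !mul0r.
by rewrite divfK// gt_eqF// send_prob_gt0.
Qed.

Lemma sample_variance_le e x j : 0 < e ->
  ((x j)%:R / send_prob e x j) ^+ 2
      * (send_prob e x j * (1 - send_prob e x j))
    <= e ^+ 2 * (F2 x)%:R / 3.
Proof.
move=> e0; have [->|xj] := posnP (x j).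
  by rewrite mul0r expr0n mul0r divr_ge0// mulr_ge0// ltW// exprn_gt0.
have q0 := send_prob_gt0 e0 xj.
have y0 : 0 < (x j)%:R :> R by rewrite ltr0n.
have F0 : 0 < (F2 x)%:R :> R by rewrite ltr0n (F2_gt0 xj).
have B0 : 0 < e ^+ 2 * (F2 x)%:R by rewrite mulr_gt0// exprn_gt0.
set q := send_prob e x j in q0 *.
(* An entry sent with certainty has no variance. Otherwise the minimum is its second argument,
   [x ^ 2 / q] equals [e ^ 2 * F2 / 3] exactly, and the variance is that times [1 - q]. *)
have [q1|q1] := leP 1 q.
  apply: (@le_trans _ _ 0); last by rewrite divr_ge0 ?ltW.
  by rewrite mulr_ge0_le0 ?sqr_ge0// mulr_ge0_le0 ?(ltW q0)// subr_le0.
have qE : q = 3 * (x j)%:R ^+ 2 / (e ^+ 2 * (F2 x)%:R).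
  by move: q1; rewrite /q /send_prob minEle; case: ifP => // _; rewrite ltxx.
have -> : e ^+ 2 * (F2 x)%:R / 3 = (x j)%:R ^+ 2 / q.
  by rewrite qE; field; rewrite !gt_eqF.
have -> : ((x j)%:R / q) ^+ 2 * (q * (1 - q)) = (x j)%:R ^+ 2 / q * (1 - q).
  by field; rewrite gt_eqF.
by rewrite ger_pMr ?divr_gt0 ?exprn_gt0// gerBl ltW.
Qed.

End sampling.

(** * Polynomial bounds on the transmitted reals *)

Section magnitude.
Context {R : realType} {k n : nat}.

Lemma Fp_le (p : R) (c q : nat) (x : 'I_n -> nat) : 0 <= p -> p <= q%:R ->
  (0 < n)%N -> (forall j, x j <= n ^ c)%N -> Fp p x <= n%:R ^+ (c * q).+1.
Proof.
move=> p0 pq n0 xn; have nc : 1 <= (n ^ c)%:R :> R by rewrite ler1n expn_gt0 n0.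
apply: (@le_trans _ _ (\sum_(j < n) (n%:R ^+ (c * q) : R))); last first.
  by rewrite sumr_const card_ord exprS mulr_natl.
apply: ler_sum => j _.
rewrite exprM -natrX -powR_mulrn//.
apply: (@le_trans _ _ ((n ^ c)%:R `^ p)); last exact: ler_powR.
by rewrite ge0_ler_powR ?nnegrE ?ler_nat.
Qed.

(** There are [k * n] entries, so the [p]-th power is at most [k * n * n ^ (c * p)], and
    [k * n <= (k * n) ^ p]. The factor [k] is kept explicit because it cancels against the unit
    [k * n ^- b]; no bound on [k] in terms of [n] is assumed. *)
Lemma lp'_le (p : R) (c : nat) (v : 'I_k -> 'I_n -> nat) : 1 <= p ->
  (0 < k)%N -> (0 < n)%N -> (forall i j, v i j <= n ^ c)%N ->
  lp' p v <= k%:R * n%:R ^+ c.+1.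
Proof.
move=> p1 k0 n0 vn; have p0 : 0 < p by lra.
have B0 : 0 <= k%:R * n%:R ^+ c.+1 :> R by rewrite mulr_ge0// exprn_ge0.
have -> : k%:R * n%:R ^+ c.+1 = ((k%:R * n%:R ^+ c.+1) `^ p) `^ p^-1 :> R.
  by rewrite -powRrM mulfV ?gt_eqF// powRr1.
rewrite ge0_ler_powR ?nnegrE ?invr_ge0 ?powR_ge0 ?(ltW p0)//.
  by apply: sumr_ge0 => i _; apply: sumr_ge0 => j _; exact: powR_ge0.
apply: (@le_trans _ _ (\sum_(i < k) \sum_(j < n) (n ^ c)%:R `^ p)).
  apply: ler_sum => i _; apply: ler_sum => j _.
  by rewrite ge0_ler_powR ?nnegrE ?ler_nat ?(ltW p0).
rewrite !sumr_const !card_ord -mulrnA -[leLHS]mulr_natl exprS mulrA.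
rewrite -natrX powRM//.
rewrite ler_wpM2r ?powR_ge0// mulnC natrM.
by rewrite le1r_powR// -natrM ler1n muln_gt0 k0.
Qed.

End magnitude.

(** * Accuracy of the estimate and expected cost of the protocol *)

Section guarantees.
Context {R : realType} {k n : nat} {d : measure_display} {T : measurableType d}.
Variables (P : probability T R) (p eps : R) (v : 'I_k -> 'I_n -> nat).
Variable sent : 'I_k -> 'I_n -> set T.
Hypothesis p2 : 2 <= p.
Hypothesis k0 : (0 < k)%N.
Hypothesis eps01 : 0 < eps < 1.
Hypothesis msent : forall i j, measurable (sent i j).
Hypothesis Psent : forall i j, P (sent i j) = (prob p eps v i j)%:E.
Hypothesis indep :
  mutually_independent P (fun ij : 'I_k * 'I_n => sent ij.1 ij.2).

(** Mutual independence applied to a two-element set: the form that the variance of a single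
    coordinate [j] requires. *)
Lemma pairwise_sent (i i' : 'I_k) (j : 'I_n) : i != i' ->
  P (sent i j `&` sent i' j) = (prob p eps v i j * prob p eps v i' j)%:E.
Proof.
move=> ii'; have := indep [set (i, j); (i', j)]%SET.
rewrite big_setU1 ?big_set1/= ?Psent ?inE ?xpair_eqE ?(negPf ii')// -EFinM => <-.
congr (P _); apply/seteqP; split => [w [wi wi'] ij /=|w /= h].
  by rewrite !inE => /orP[]/eqP->.
by split; [apply: (h (i, j))|apply: (h (i', j))]; rewrite /= !inE eqxx ?orbT.
Qed.

Lemma sum_vtilde_near (j : 'I_n) :
  `|\sum_(i < k) (vtilde p eps v i j)%:R - (vsum v j)%:R| <= eps * lp' p v.
Proof.
have K0 : 0 < k%:R :> R by rewrite ltr0n.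
rewrite natr_sum -sumrB.
apply: (le_trans (ler_norm_sum _ _ _)).
have -> : eps * lp' p v = \sum_(i < k) (eps * lp' p v / k%:R).
  by rewrite sumr_const card_ord -[RHS]mulr_natr divfK// gt_eqF.
case/andP: eps01 => e0 _.
apply: ler_sum => i _; rewrite /vtilde /thresholded; case: ifPn => [_|].
  by rewrite subrr normr0 divr_ge0 ?mulr_ge0 ?lp'_ge0 ?(ltW e0).
by rewrite -ltNge => /ltW; rewrite sub0r normrN ger0_norm.
Qed.

Lemma vhat_near (j : 'I_n) :
  ((2 / 3)%:E <=
    P [set w | `| vhat sent p eps v j w - (vsum v j)%:R |
               <= 2 * eps * lp' p v]%R)%E.
Proof.
case/andP: (eps01) => e0 _.
(* If the norm is 0, all entries vanish and the estimate is exact for every outcome. Otherwise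
   Chebyshev has the positive radius [eps * lp' p v]. *)
have [L0|L0] := eqVneq (lp' p v) 0.
  have v0 i j' : v i j' = 0%N.
    by apply: lp'_eq0 L0; rewrite gt_eqF// (lt_le_trans _ p2).
  rewrite (_ : [set _ | _] = setT) ?probability_setT ?lee_fin.
    by rewrite ler_pdivrMr// mul1r ler_nat.
  apply/seteqP; split => // w _ /=; rewrite L0 mulr0.
  rewrite /vhat /vsum !big1 ?subrr ?normr0// => i _.
  by rewrite /vtilde /thresholded v0 if_same !mul0r.
have {L0} L0 : 0 < lp' p v by rewrite lt0r L0 lp'_ge0.
have e'0 := eps_sampling_gt0 p k0 e0.
pose q i := prob p eps v i j; pose a i : R := (vtilde p eps v i j)%:R / q i.
have aq : \sum_i a i * q i = \sum_i (vtilde p eps v i j)%:R.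
  by apply: eq_bigr => i _; exact: sample_mean.
(* The 3 in the sampling probability becomes the failure probability [1 / 3]. *)
have hs : \sum_i a i ^+ 2 * (q i * (1 - q i)) <= 1 / 3 * (eps * lp' p v) ^+ 2.
  rewrite mulrC mul1r.
  apply: (@le_trans _ _ (\sum_(i < k) eps_sampling (k := k) p eps ^+ 2
      * (F2 (vtilde p eps v i))%:R / 3)).
    by apply: ler_sum => i _; exact: sample_variance_le.
  by rewrite -mulr_suml -mulr_sumr ler_pM2r// eps_sampling_sum_F2_le.
have := chebyshev_sum_indic (msent^~ j) (Psent^~ j)
  (fun i i' ii' => pairwise_sent j ii') (mulr_gt0 e0 L0) hs.
rewrite (_ : 1 - 1 / 3 = 2 / 3); last by field.
move=> /le_trans; apply.
have mX : measurable_fun setT (vhat sent p eps v j).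
  exact: (measurable_sum_indic P a (msent^~ j)).
apply: le_measure.
- have := measurable_dist_itv (\sum_i a i * q i) `]-oo, eps * lp' p v[ mX.
  by move=> h; apply/mem_set; move: h; under eq_set do rewrite in_itv/=.
- have := measurable_dist_itv (vsum v j)%:R `]-oo, 2 * eps * lp' p v] mX.
  by move=> h; apply/mem_set; move: h; under eq_set do rewrite in_itv/=.
(* Triangle inequality through the sum of the thresholded entries: sampling and thresholding each
   cost at most [eps * lp' p v]. *)
move=> w /= hw; have hv := sum_vtilde_near j; rewrite -aq in hv.
rewrite (_ : 2 * _ * _ = eps * lp' p v + eps * lp' p v); last by ring.
exact: (le_trans (ler_distD _ _ _) (lerD (ltW hw) hv)).
Qed.

Lemma sum_prob_le :
  \sum_(i < k) \sum_(j < n) prob p eps v i j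
    <= 3 * (k%:R `^ (p - 1) / eps `^ p).
Proof.
case/andP: (eps01) => e0 _; have e'0 := eps_sampling_gt0 p k0 e0.
have K0 : 0 < k%:R :> R by rewrite ltr0n.
apply: (@le_trans _ _ (\sum_(i < k) 3 / eps_sampling (k := k) p eps ^+ 2)).
  by apply: ler_sum => i _; exact: sum_send_prob_le.
rewrite sumr_const card_ord -mulr_natl eps_sampling_sqr invf_div.
(* The [k] sites contribute [k * k ^ (p - 2) = k ^ (p - 1)]. *)
rewrite -(mulr_powRB1 (ltW K0) (_ : 0 < p - 1)); last first.
  by rewrite subr_gt0 (lt_le_trans _ p2)// ltr1n.
rewrite (_ : p - 1 - 1 = p - 2); last by ring.
by rewrite le_eqVlt; apply/orP; left; apply/eqP; ring.
Qed.

Lemma comm_cost_expectation (b : nat) :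
  ('E_P[comm_cost b sent p eps v] =
    (\sum_(i < k) (real_bits (n%:R ^- b) (Fp p (v i)))%:R
     + k%:R * (real_bits (k%:R * n%:R ^- b) (lp' p v))%:R
     + \sum_(i < k) (nat_bits (F2 (vtilde p eps v i)))%:R
     + \sum_(i < k) \sum_(j < n)
         (up_log 2 n + nat_bits (vtilde p eps v i j))%N%:R
         * prob p eps v i j)%R%:E)%E.
Proof.
pose beta (ij : 'I_k * 'I_n) : R :=
  (up_log 2 n + nat_bits (vtilde p eps v ij.1 ij.2))%N%:R.
pose A (ij : 'I_k * 'I_n) := sent ij.1 ij.2.
pose Y w := \sum_ij beta ij * \1_(A ij) w.
have mA ij : measurable (A ij) by exact: msent.
have Y1 : Y \in Lfun P 1.
  by apply: Lfun_subset12; rewrite ?fin_num_measure// Lfun2_sum_indic.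
(* [Z] collects the messages whose lengths do not depend on the coins; only the sampled entries are
   random. *)
set Z := (X in (X + _)%:E).
have -> : comm_cost b sent p eps v = cst Z \+ Y.
  by apply/funext => w; rewrite /comm_cost pair_big.
rewrite expectationD ?Lfun_cst// expectation_cst expectation_sum_indic//.
clearbody Z; rewrite pair_big/= EFinD -sumEFin; congr (_ + _)%E.
by apply: eq_bigr => ij _; rewrite Psent EFinM.
Qed.

End guarantees.

Theorem theorem3 (R : realType) (p : R) (hp : 2 <= p) (c b : nat) :
  exists C : R, 0 < C /\
    forall (k n : nat) (eps : R) (v : 'I_k -> 'I_n -> nat),
      (1 <= k)%N -> (2 <= n)%N -> 0 < eps < 1 ->
      (forall i j, (v i j <= n ^ c)%N) ->
    forall (d : measure_display) (T : measurableType d) (P : probability T R)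
      (sent : 'I_k -> 'I_n -> set T),
      (forall i j, measurable (sent i j)) ->
      (forall i j, P (sent i j) = (prob p eps v i j)%:E) ->
      mutually_independent P (fun ij : 'I_k * 'I_n => sent ij.1 ij.2) ->
      (forall j : 'I_n,
         ((2 / 3)%:E <=
          P [set w | `| vhat sent p eps v j w - (vsum v j)%:R |
                     <= 2 * eps * lp' p v]%R)%E) /\
      ('E_P [comm_cost b sent p eps v] <=
         (C * (k%:R `^ (p - 1) * ln n%:R / eps `^ p))%:E)%E.
Proof.
have p0 : 0 < p by lra.
have p1 : 1 <= p by lra.
(* [p] is real; a natural upper bound keeps the powers of [n] integral. A single exponent [e] then
   dominates all four kinds of transmitted numbers. *)
have [q pq] : exists q : nat, p <= q%:R.
  by exists (Num.truncn p).+1; rewrite ltW// truncnS_gt.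
have [e [eF eL eF2 ec]] : exists e, [/\ (c * q).+1 + b <= e, c.+1 + b <= e,
    (c * 2).+1 <= e & c <= e]%N.
  by exists (c * q + 2 * c + b).+1; split; lia.
pose K : R := (2 * e + 3)%N%:R / ln 2.
have l2 : 0 < ln 2 :> R by rewrite ln_gt0 // ltr1n.
have K0 : 0 < K by rewrite divr_gt0// ltr0n.
(* Each of the three kinds of unconditional message costs at most [K * M * ln n] in total. The
   samples cost [6 * K * M * ln n]: [3 * M] of them are expected, at [2 * K * ln n] bits each for
   index and value. *)
exists (9 * K); split; first by rewrite mulr_gt0.
move=> k n eps v k0 n2 eps01 vn d T P sent msent Psent indep.
split; first by move=> j; exact: vhat_near.
rewrite comm_cost_expectation// lee_fin.
case/andP: (eps01) => e0 e1.
have n1 : 1 <= n%:R :> R by rewrite ler1n ltnW.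
have n0 : (0 < n)%N by rewrite ltnW.
have k0R : 0 < k%:R :> R by rewrite ltr0n.
have lnn : 0 < ln n%:R :> R by rewrite ln_gt0// ltr1n.
set M : R := k%:R `^ (p - 1) / eps `^ p.
(* Since [eps ^ p <= 1] and [p - 1 >= 1], the cost of one message per site is absorbed into the
   bound for the samples. *)
have kM : k%:R <= M.
  rewrite ler_pdivlMr ?powR_gt0//.
  apply: (@le_trans _ _ k%:R).
    rewrite ler_piMr// -[leRHS](powRr0 eps).
    by apply: ger_powR; rewrite ?e0 ?(ltW e1) ?(ltW p0).
  by rewrite le1r_powR ?ler1n//; lra.
have hF i : (real_bits (n%:R ^- b) (Fp p (v i)))%:R <= K * ln n%:R.
  apply: real_bits_le => //; rewrite invrK.
  apply: (@le_trans _ _ (n%:R ^+ (c * q).+1 * n%:R ^+ b)).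
    by rewrite ler_wpM2r ?exprn_ge0// Fp_le// ltW.
  by rewrite -exprD ler_weXn2l.
have hL : (real_bits (k%:R * n%:R ^- b) (lp' p v))%:R <= K * ln n%:R.
  apply: real_bits_le => //.
  rewrite ler_pdivrMr; last by rewrite mulr_gt0// invr_gt0 exprn_gt0// ltr0n.
  apply: (le_trans (lp'_le p1 k0 n0 vn)).
  rewrite mulrCA ler_wpM2l// ler_pdivlMr ?exprn_gt0 ?ltr0n//.
  by rewrite -exprD ler_weXn2l.
have tn i j : (vtilde p eps v i j <= n ^ c)%N.
  exact: leq_trans (thresholded_le _ _ _ _) (vn i j).
have hF2 i : (nat_bits (F2 (vtilde p eps v i)))%:R <= K * ln n%:R.
  apply: nat_bits_le => //; apply: (@leq_trans (\sum_(j < n) n ^ (c * 2))).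
    by apply: leq_sum => j _; rewrite expnM leq_exp2r.
  by rewrite sum_nat_const card_ord -expnS leq_exp2l.
have hS i j : (up_log 2 n + nat_bits (vtilde p eps v i j))%N%:R
    <= 2 * K * ln n%:R.
  have h1 := @up_log2_le R n n2.
  have h2 : (nat_bits (vtilde p eps v i j))%:R <= K * ln n%:R.
    apply: nat_bits_le => //; apply: (leq_trans (tn i j)).
    by rewrite leq_exp2l.
  (* The index is no more expensive than the value, because [2 <= 2 * e + 3]. *)
  have h3 : 2 / ln 2 * ln n%:R <= K * ln n%:R.
    by rewrite ler_pM2r// /K ler_pM2r ?invr_gt0// ler_nat ltn_addl.
  by rewrite natrD; lra.
have sumK (F : 'I_k -> R) : (forall i, F i <= K * ln n%:R) ->
    \sum_(i < k) F i <= M * (K * ln n%:R).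
  move=> hle; apply: (@le_trans _ _ (\sum_(i < k) K * ln n%:R)).
    exact: ler_sum.
  by rewrite sumr_const card_ord -[leLHS]mulr_natl ler_wpM2r// mulr_ge0// ltW.
have hsend : \sum_(i < k) \sum_(j < n)
      (up_log 2 n + nat_bits (vtilde p eps v i j))%N%:R * prob p eps v i j
    <= 2 * K * ln n%:R * (3 * M).
  apply: (@le_trans _ _ (2 * K * ln n%:R
      * \sum_(i < k) \sum_(j < n) prob p eps v i j)).
    rewrite mulr_sumr; apply: ler_sum => i _.
    rewrite mulr_sumr; apply: ler_sum => j _.
    by rewrite ler_wpM2r ?send_prob_ge0.
  apply: ler_wpM2l; last exact: sum_prob_le.
  exact: mulr_ge0 (mulr_ge0 (ler0n _ 2) (ltW K0)) (ltW lnn).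
have -> : 9 * K * (k%:R `^ (p - 1) * ln n%:R / eps `^ p)
    = M * (K * ln n%:R) + M * (K * ln n%:R) + M * (K * ln n%:R)
      + 2 * K * ln n%:R * (3 * M).
  by rewrite /M; ring.
rewrite !lerD ?sumK//.
by apply: ler_pM => //; rewrite ltW.
Qed.
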